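(* For every positive integer $k$, $\beta_{2k,k}\le 1-\frac{1}{\sqrt[k]{15}}$, and consequently $\alpha_{2k-1,k}\ge\frac{1}{\sqrt[k]{15}}$.
   Context: For a family of subsets of a set $X$, a hitting set is a subset $Y\subseteq X$ meeting every member of the family. For a positive integer $m$ and $k\in\{1,\dots,m\}$, $\beta_{m,k}$ is the smallest real number $\beta$ such that: for any finite set $X$ and any $m$ subsets $A_1,\dots,A_m$ of $X$ with $|A_i|>\beta|X|$ for all $i$, there is a hitting set for $\{A_1,\dots,A_m\}$ of size at most $k$. For a finite family $\mathcal{F}$ of convex sets in $\mathbb{R}^d$ and $p\in\mathbb{R}^d$, $\operatorname{dep}_\mathcal{F}(p)$ is the smallest number of sets of $\mathcal{F}$ intersected by a closed halfspace containing $p$. A family is $k$-intersecting if every subfamily of at most $k$ members has nonempty intersection. For integers $1\le k\le d+1$, $\alpha_{d,k}$ is the largest real number such that every finite $k$-intersecting family $\mathcal{F}$ of convex sets in $\mathbb{R}^d$ has a point $p$ with $\operatorname{dep}_\mathcal{F}(p)\ge\alpha_{d,k}|\mathcal{F}|$. *)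

(* Defs.v *)
From HB Require Import structures.
From mathcomp Require Import all_boot all_order all_algebra.
From mathcomp Require Import all_classical all_reals all_analysis.

Set Implicit Arguments.
Unset Strict Implicit.
Unset Printing Implicit Defensive.

Import Order.TTheory GRing.Theory Num.Theory.

Local Open Scope classical_set_scope.
Local Open Scope ring_scope.

(* Families are indexed by ordinals, so that a set may occur several times; the
   size of a family is that of its index set. *)

Definition hitting_set (X : finType) (m : nat) (A : 'I_m -> {set X})
    (Y : {set X}) : Prop :=
  forall i, exists2 x, x \in Y & x \in A i.

Definition hitting_threshold (R : realType) (m k : nat) (b : R) : Prop :=
  forall (X : finType) (A : 'I_m -> {set X}),
    (forall i, b * #|X|%:R < #|A i|%:R) ->
    exists2 Y : {set X}, (#|Y| <= k)%N & hitting_set A Y.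

(* The infimum is a minimum when 0 < m: see beta_attained and beta_minimal. *)
Definition beta (R : realType) (m k : nat) : R :=
  inf [set b : R | hitting_threshold m k b].

Definition closed_halfspace (R : realType) (d : nat) (H : set 'rV[R]_d) : Prop :=
  exists u : 'rV[R]_d, exists c : R,
    u != 0 /\ H = [set x | \sum_(j < d) u 0 j * x 0 j <= c].

Definition crossing_number (R : realType) (d n : nat)
    (F : 'I_n -> set 'rV[R]_d) (H : set 'rV[R]_d) : nat :=
  #|[set i : 'I_n | `[< F i `&` H !=set0 >]]%SET|.

(* A minimum when 0 < d, see dep_attained and dep_minimal; for d = 0 there is
   no closed halfspace, and dep is 0. *)
Definition dep (R : realType) (d n : nat) (F : 'I_n -> set 'rV[R]_d)
    (p : 'rV[R]_d) : R :=
  inf [set (crossing_number F H)%:R | H in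
         [set H : set 'rV[R]_d | closed_halfspace H /\ H p]].

Definition k_intersecting (R : realType) (d n k : nat)
    (F : 'I_n -> set 'rV[R]_d) : Prop :=
  forall I : {set 'I_n}, (#|I| <= k)%N ->
    \bigcap_(i in [set i | i \in I]) F i !=set0.

Definition depth_fraction (R : realType) (d k : nat) (a : R) : Prop :=
  forall (n : nat) (F : 'I_n -> set 'rV[R]_d),
    (forall i, convex_set (F i)) -> k_intersecting k F ->
    exists p : 'rV[R]_d, a * n%:R <= dep F p.

(* The supremum is a maximum when 0 < d: see alpha_attained and alpha_maximal. *)
Definition alpha (R : realType) (d k : nat) : R :=
  sup [set a : R | depth_fraction d k a].

Lemma beta_has_lbound (R : realType) (m k : nat) : (0 < m)%N ->
  has_lbound [set b : R | hitting_threshold m k b].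
Proof.
move=> m0; exists 0 => b /= hb; rewrite leNgt; apply/negP => b0.
have [|Y _ /(_ (Ordinal m0)) [x _]] := hb unit (fun=> finset.set0).
  by move=> i; rewrite finset.cards0 card_unit mulr1.
by rewrite finset.in_set0.
Qed.

Lemma beta_minimal (R : realType) (m k : nat) (b : R) : (0 < m)%N ->
  hitting_threshold m k b -> beta R m k <= b.
Proof. by move=> m0 hb; apply: ge_inf => //; exact: beta_has_lbound. Qed.

Lemma beta_attained (R : realType) (m k : nat) : (0 < m)%N ->
  hitting_threshold m k (beta R m k).
Proof.
move=> m0 X A hA; set i0 := Ordinal m0.
have X0 : (0 < #|X|)%N.
  rewrite lt0n; apply/eqP => X0; have := hA i0.
  have := max_card (mem (A i0)).
  by rewrite X0 leqn0 => /eqP ->; rewrite mulr0 ltxx.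
have [i _ imin] := @arg_minnP _ i0 predT (fun i => #|A i|) isT.
have [||b /= hb bi] :=
  @inf_lt R [set b : R | hitting_threshold m k b] (#|A i|%:R / #|X|%:R).
- exists 1 => Y B /(_ i0); rewrite mul1r ltr_nat ltnNge.
  by rewrite max_card.
- by rewrite ltr_pdivlMr ?ltr0n//; exact: hA.
apply: hb => j; apply: (@lt_le_trans _ _ #|A i|%:R).
  by rewrite -ltr_pdivlMr ?ltr0n.
by rewrite ler_nat imin.
Qed.

Lemma dep_minimal (R : realType) (d n : nat) (F : 'I_n -> set 'rV[R]_d)
    (p : 'rV[R]_d) (H : set 'rV[R]_d) :
  closed_halfspace H -> H p -> dep F p <= (crossing_number F H)%:R.
Proof.
move=> hH Hp; apply: ge_inf; last by exists H.
by exists 0 => _ [H' _ <-].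
Qed.

Lemma dep_attained (R : realType) (d n : nat) (F : 'I_n -> set 'rV[R]_d)
    (p : 'rV[R]_d) : (0 < d)%N ->
  exists2 H, closed_halfspace H /\ H p & dep F p = (crossing_number F H)%:R.
Proof.
move=> d0.
pose P j := `[< exists2 H, closed_halfspace H /\ H p
                         & crossing_number F H = j >].
have exP : exists j, P j.
  pose u : 'rV[R]_d := const_mx 1.
  pose H := [set x : 'rV[R]_d |
    \sum_(j < d) u 0 j * x 0 j <= \sum_(j < d) u 0 j * p 0 j].
  exists (crossing_number F H); apply/asboolP; exists H => //; split; last exact: lexx.
  exists u, (\sum_(j < d) u 0 j * p 0 j); split => //.
  apply/eqP => /matrixP/(_ 0 (Ordinal d0)).
  by rewrite !mxE => /eqP; rewrite oner_eq0.
case: (ex_minnP exP) => j /asboolP[H [hH Hp] <-] jmin.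
exists H => //; apply/eqP; rewrite eq_le dep_minimal//=.
apply: lb_le_inf; first by exists (crossing_number F H)%:R, H.
move=> _ [H' [hH' H'p] <-]; rewrite ler_nat jmin//.
by apply/asboolP; exists H'.
Qed.

Lemma alpha_has_ubound (R : realType) (d k : nat) : (0 < d)%N ->
  has_ubound [set a : R | depth_fraction d k a].
Proof.
move=> d0; exists 1 => a /(_ 1%N (fun=> setT)) [i|I _|p].
- by move=> x y l _ _; rewrite inE.
- by exists 0 => i _.
rewrite mulr1 => /le_trans; apply.
have [H _ ->] := dep_attained (fun _ : 'I_1 => setT) p d0.
by rewrite lern1 -[leqRHS]card_ord max_card.
Qed.

Lemma alpha_maximal (R : realType) (d k : nat) (a : R) : (0 < d)%N ->
  depth_fraction d k a -> a <= alpha R d k.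
Proof. by move=> d0 ha; apply: ub_le_sup => //; exact: alpha_has_ubound. Qed.

Lemma alpha_attained (R : realType) (d k : nat) : (0 < d)%N ->
  depth_fraction d k (alpha R d k).
Proof.
move=> d0 n F cF iF.
pose P j := `[< exists p, dep F p = j%:R :> R >].
have exP : exists j, P j.
  have [H _ e] := dep_attained F 0 d0.
  by exists (crossing_number F H); apply/asboolP; exists 0.
have ubP j : P j -> (j <= n)%N.
  move=> /asboolP[p]; have [H _ ->] := dep_attained F p d0.
  by move=> /eqP; rewrite eqr_nat => /eqP <-; rewrite -[leqRHS]card_ord max_card.
case: (ex_maxnP exP ubP) => j /asboolP[p pj] jmax; exists p.
have [n0|n0] := posnP n; first by rewrite pj [X in _ * X%:R]n0 mulr0 ler0n.
rewrite -ler_pdivlMr ?ltr0n//; apply: ge_sup.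
  exists 0 => n' F' _ _; exists 0; rewrite mul0r.
  by have [H _ ->] := dep_attained F' 0 d0; rewrite ler0n.
move=> a /(_ n F cF iF)[q hq]; rewrite ler_pdivlMr ?ltr0n//.
apply: (le_trans hq); rewrite pj.
have [H _ e] := dep_attained F q d0; rewrite e ler_nat jmax//.
by apply/asboolP; exists q.
Qed.

(* Main.v *)
(* Let q = 15^(-1/k). If every set misses at most a fraction q of X, averaging
   gives a point missing at most a fraction q of any subfamily, so j greedily
   chosen points miss at most 2k q^j of the 2k sets. As 15^3 >= 5^5, the choice
   j = k - floor(2k/5) >= 3k/5 gives q^j <= 1/5, so at most floor(2k/5) = k - j
   sets remain, and these are hit by one point each.

   For the depth, let b = 1 - q and apply Helly's theorem to the convex hulls
   C_S of the unions of the F_i, i in S, over all S with |S| > b n. Any d + 1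
   of these S have a hitting set of size k, and the common point of the
   corresponding F_i lies in all d + 1 hulls. A closed halfspace through a
   point p common to all C_S cannot avoid more than b n of the F_i, since its
   complement would be a convex set containing some C_S but not p. *)

Require Import Defs.
From mathcomp Require Import all_boot all_order all_algebra.
From mathcomp Require Import all_classical all_reals all_analysis.
From mathcomp Require Import zify lra.

Set Implicit Arguments.
Unset Strict Implicit.
Unset Printing Implicit Defensive.

Import Order.TTheory GRing.Theory Num.Theory.
Local Open Scope ring_scope.

(** * Convex combinations and Helly's theorem *)

Lemma convex_setP (R : realType) (V : lmodType R) (C : set V) :
  convex_set C <-> forall (x y : V) (s t : R), 0 <= s -> 0 <= t -> s + t = 1 ->
    C x -> C y -> C (s *: x + t *: y).
Proof.
split=> [convC x y s t s0 t0 st Cx Cy|convC x y l].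
  have s1 : s <= 1 by rewrite -st lerDl.
  have := convC x y (Itv01 s0 s1) (mem_set Cx) (mem_set Cy).
  rewrite inE; congr C; congr (_ + _ *: _).
  by rewrite [RHS](_ : _ = 1 - s)// -st addrC addKr.
rewrite !inE => Cx Cy.
apply: convC => //.
- by change (0 <= 1 - l%:num); rewrite subr_ge0 le1.
- exact: etrans (addrC _ _) (subrK _ _).
Qed.

Lemma convex_set_barycenter (R : realType) (V : lmodType R) (C : set V)
    (I : finType) (P : pred I) (w : I -> R) (p : I -> V) :
  convex_set C -> (forall i, P i -> 0 <= w i) -> (forall i, P i -> C (p i)) ->
  0 < \sum_(i | P i) w i ->
  C ((\sum_(i | P i) w i)^-1 *: \sum_(i | P i) w i *: p i).
Proof.
move=> convC w0 pC.
(* Closed under addition, unlike membership in C; the case s = 0 accounts for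
   zero weights. *)
pose K (s : R) (v : V) := (s = 0 /\ v = 0) \/ (0 < s /\ C (s^-1 *: v)).
suff : K (\sum_(i | P i) w i) (\sum_(i | P i) w i *: p i).
  by move=> [[-> _]|[]//]; rewrite ltxx.
apply: (big_ind2 K) => [|s v t u|i Pi]; first by left.
- move=> [[-> ->]|[s0 Cs]] [[-> ->]|[t0 Ct]]; rewrite ?addr0 ?add0r.
  + by left.
  + by right.
  + by right.
  + right; split; first exact: addr_gt0.
    have st0 : 0 < s + t by exact: addr_gt0.
    have : C ((s / (s + t)) *: (s^-1 *: v) + (t / (s + t)) *: (t^-1 *: u)).
      apply: (convex_setP C).1 => //; rewrite ?divr_ge0 ?(ltW s0) ?(ltW t0)
        ?(ltW st0)//.
      by rewrite -mulrDl mulfV// gt_eqF.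
    by rewrite !scalerA scalerDr !(mulrAC _ (_ + _)^-1) !mulfV ?gt_eqF// !mul1r.
- have := w0 _ Pi; rewrite le_eqVlt => /predU1P[<-|wi0].
    by left; rewrite scale0r.
  by right; split => //; rewrite scalerA mulVf ?gt_eqF// scale1r; exact: pC.
Qed.

(** The rows (1, [p i]) have d + 1 entries, so more than d + 1 of them are linearly dependent; the
    column of ones makes the coefficients sum to zero. *)
Lemma affine_dependence (F : fieldType) (d : nat) (T : finType) (I : {set T})
    (p : T -> 'rV[F]_d) :
  (d.+1 < #|I|)%N ->
  exists a : T -> F, [/\ exists2 i, i \in I & a i != 0,
    \sum_(i in I) a i = 0 & \sum_(i in I) a i *: p i = 0].
Proof.
move=> dI.
have [x0 x0I] : exists x, x \in I.
  by apply/set0Pn; rewrite -card_gt0; apply: leq_ltn_trans dI.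
pose M : 'M[F]_(#|I|, 1 + d) :=
  row_mx (const_mx 1) (\matrix_i p (enum_val i)).
have /rowV0Pn[c /sub_kermxP cM c0] : kermx M != 0.
  by rewrite -mxrank_eq0 mxrank_ker subn_eq0 -ltnNge (leq_ltn_trans (rank_leq_col M)).
exists (fun x => c 0 (enum_rank_in x0I x)).
move: cM; rewrite mul_mx_row -[RHS]row_mx0 => /eq_row_mx[c1 c2].
split.
- have /rV0Pn[j cj] := c0.
  by exists (enum_val j); rewrite ?enum_valP// enum_valK_in.
- rewrite big_enum_val/=; move/matrixP/(_ 0 0): c1; rewrite !mxE => c1.
  by rewrite -[RHS]c1; apply: eq_bigr => i _; rewrite enum_valK_in mxE mulr1.
- rewrite big_enum_val/= -[RHS]c2 mulmx_sum_row.
  by apply: eq_bigr => i _; rewrite enum_valK_in rowK.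
Qed.

Lemma helly (R : realType) (d : nat) (T : finType) (C : T -> set 'rV[R]_d)
    (I : {set T}) :
  (forall i, i \in I -> convex_set (C i)) ->
  (forall J : {set T}, J \subset I -> (#|J| <= d.+1)%N ->
    exists x, forall j, j \in J -> C j x) ->
  exists x, forall i, i \in I -> C i x.
Proof.
have [m] := ubnP #|I|; elim: m I => // m IHm I Im convC interC.
have [Id|dI] := leqP #|I| d.+1; first exact: interC.
(* The induction hypothesis for [I :\ i] yields [p i]; outside [I] the value 0 is a dummy that makes
   [p] total. *)
have /choice[p pC] : forall i, exists x, i \in I ->
    forall j, j \in I :\ i -> C j x.
  move=> i; have [iI|iI] := boolP (i \in I); last by exists 0.
  have [|j /setD1P[_]|J JI Jd|x xC] := IHm (I :\ i)%SET.
  - by rewrite -ltnS (leq_trans _ Im)// ltnS [ltnRHS](cardsD1 i) iI.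
  - exact: convC.
  - by apply: interC => //; apply: fintype.subset_trans JI (subsetDl _ _).
  - by exists x.
(* Radon: the positive and negative parts of an affine dependence have the
   same barycenter, and C j contains all p i of the part not containing j. *)
have [a [[i0 i0I ai0] a0 ap0]] := affine_dependence p dI.
pose s := \sum_(i in I | 0 < a i) a i.
have sN : \sum_(i in I | ~~ (0 < a i)) - a i = s.
  apply/eqP; rewrite sumrN eq_sym -subr_eq0 opprK.
  by rewrite -(bigID (fun i => 0 < a i)) a0.
have s0 : 0 < s.
  (* Here 2s is the sum of all |[a i]|, positive because [a i0] is nonzero. *)
  rewrite -[_ < _](pmulrn_lgt0 _ (isT : 0 < 2)%N) mulr2n -[X in _ + X]sN /s.
  have -> : \sum_(i in I | 0 < a i) a i + \sum_(i in I | ~~ (0 < a i)) - a i =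
      \sum_(i in I) `|a i|.
    rewrite [RHS](bigID (fun i => 0 < a i))/=; congr (_ + _).
      by apply: eq_bigr => i /andP[_ /gtr0_norm].
    by apply: eq_bigr => i /andP[_]; rewrite -leNgt => /ler0_norm.
  rewrite (bigD1 i0)//= ltr_pwDl ?normr_gt0//.
  by apply: sumr_ge0.
have pN : \sum_(i in I | ~~ (0 < a i)) - a i *: p i =
    \sum_(i in I | 0 < a i) a i *: p i.
  under eq_bigr do rewrite scaleNr.
  apply/eqP; rewrite sumrN eq_sym -subr_eq0 opprK.
  by rewrite -(bigID (fun i => 0 < a i)) ap0.
exists (s^-1 *: \sum_(i in I | 0 < a i) a i *: p i) => j jI.
have [aj|aj] := boolP (0 < a j).
- rewrite -pN -[X in X^-1]sN; apply: convex_set_barycenter; first exact: convC.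
  + by move=> i /andP[_]; rewrite -leNgt oppr_ge0.
  + move=> i /andP[iI ai]; apply: pC => //.
    by rewrite !inE jI andbT; apply: contraNneq ai => <-.
  + by rewrite sN.
- apply: convex_set_barycenter => //; first exact: convC.
  + by move=> i /andP[_ /ltW].
  + move=> i /andP[iI ai]; apply: pC => //.
    by rewrite !inE jI andbT; apply: contraNneq aj => ->.
Qed.

(** * From hitting sets to depth *)

(** As an intersection of convex supersets, the hull lies in any convex set containing [A] by
    definition. *)
Definition conv_hull (R : realType) (V : lmodType R) (A : set V) : set V :=
  [set x | forall C : set V, convex_set C -> A `<=` C -> C x]%classic.

Lemma convex_conv_hull (R : realType) (V : lmodType R) (A : set V) :
  convex_set (conv_hull A).
Proof.
apply/convex_setP => x y s t s0 t0 st xA yA C convC AC.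
by apply: (convex_setP C).1 => //; [exact: xA|exact: yA].
Qed.

Lemma convex_setC_closed_halfspace (R : realType) (d : nat)
    (H : set 'rV[R]_d) : closed_halfspace H -> convex_set (~` H)%classic.
Proof.
move=> [u [c [_ ->]]]; apply/convex_setP => x y s t s0 t0 st /=.
move=> /negP; rewrite -ltNge => cx /negP; rewrite -ltNge => cy.
apply/negP; rewrite -ltNge -[c]mul1r -st mulrDl.
rewrite (_ : \sum_j _ =
    s * (\sum_j u 0 j * x 0 j) + t * (\sum_j u 0 j * y 0 j)); last first.
  rewrite !mulr_sumr -big_split; apply: eq_bigr => j _.
  by rewrite !mxE mulrDr !(mulrCA (u 0 j)).
(* Strictness comes from [x] if s > 0, and from [y] if s = 0, where t = 1. *)
move: s0; rewrite le_eqVlt => /predU1P[s0|s0].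
  by move: st; rewrite -s0 add0r => ->; rewrite !mul0r !add0r !mul1r.
by rewrite ltr_leD ?ltr_pM2l// ler_wpM2l// ltW.
Qed.

Lemma depth_fraction_of_hitting_threshold (R : realType) (d k : nat) (b : R) :
  (0 < d)%N -> hitting_threshold d.+1 k b -> depth_fraction d k (1 - b).
Proof.
move=> d0 hb n F convF interF.
pose C (S : {set 'I_n}) := conv_hull (\bigcup_(i in [set` S]) F i)%classic.
pose large : {set {set 'I_n}} := [set S : {set 'I_n} | b * n%:R < #|S|%:R]%SET.
have [|J JI Jd|p pC] := @helly R d _ C large.
- by move=> S _; exact: convex_conv_hull.
- have [->|/set0Pn[S0 S0J]] := eqVneq J finset.set0.
    by exists 0 => S; rewrite inE.
  (* The threshold needs exactly d + 1 sets, so a smaller [J] is padded with its member [S0]; hence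
     the separate case of empty [J]. *)
  pose A (i : 'I_d.+1) := nth S0 (enum J) i.
  have AJ i : A i \in J.
    rewrite /A; have [iJ|Ji] := ltnP i (size (enum J)).
      by rewrite -mem_enum mem_nth.
    by rewrite nth_default.
  have [|Y Yk hY] := hb _ A.
    by move=> i; have /(fintype.subsetP JI) := AJ i; rewrite inE card_ord.
  have [p pY] := interF Y Yk.
  exists p => S SJ.
  have iS : (index S (enum J) < d.+1)%N.
    by apply: leq_trans Jd; rewrite cardE index_mem mem_enum.
  have [y yY] := hY (Ordinal iS); rewrite /A /= nth_index ?mem_enum// => yS.
  by move=> D _; apply; exists y => //; exact: pY.
- exists p; have [H [hH Hp] ->] := dep_attained F p d0.
  pose S : {set 'I_n} := [set i | ~~ `[< F i `&` H !=set0 >]%classic]%SET.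
  have -> : crossing_number F H = (n - #|S|)%N.
    rewrite /crossing_number cardsCs card_ord; congr (_ - _)%N.
    by apply: eq_card => i; rewrite !inE.
  rewrite natrB; last by rewrite -[leqRHS]card_ord max_card.
  rewrite mulrBl mul1r lerD2l lerN2 leNgt; apply/negP => bS.
  have : (~` H)%classic p; last exact.
  apply: (pC S); first by rewrite inE.
    exact: convex_setC_closed_halfspace.
  move=> x [i /=]; rewrite inE => /asboolPn FH Fx Hx.
  by apply: FH; exists x.
Qed.

(** * Greedy construction of hitting sets *)

Lemma greedy_hitting (R : realType) (q : R) (X T : finType) (A : T -> {set X})
    (j : nat) :
  0 <= q -> (0 < #|X|)%N -> (forall i, #|~: A i|%:R <= q * #|X|%:R) ->
  exists2 Y : {set X}, (#|Y| <= j)%N &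
    #|[set i | [disjoint Y & A i]]|%:R <= q ^+ j * #|T|%:R.
Proof.
move=> q0 X0 Aq; elim: j => [|j [Y Yj hY]].
  exists finset.set0; first by rewrite cards0.
  by rewrite expr0 mul1r ler_nat max_card.
set M := [set i | [disjoint Y & A i]]%SET in hY.
pose f x := #|[set i in M | x \notin A i]|.
(* Double counting of the pairs (x, i) with i in [M] and x outside [A i]: there are at most q |X|
   |M| of them, so some x is in at most q |M|. *)
have [x hx] : exists x, (f x)%:R <= q * #|M|%:R.
  apply: contrapT => /forallNP hf.
  have : \sum_(x : X) q * #|M|%:R < \sum_(x : X) (f x)%:R.
    have /card_gt0P[x0 _] := X0.
    apply: ltr_sum => [|x _].
      by apply/hasP; exists x0; rewrite ?mem_index_enum.
    by rewrite ltNge; apply/negP; exact: hf.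
  apply/negP; rewrite -leNgt -natr_sum.
  have -> : \sum_(x : X) q * #|M|%:R = q * #|X|%:R * #|M|%:R.
    by rewrite sumr_const mulrAC [RHS]mulr_natr; congr (_ *+ _).
  have -> : (\sum_x f x = \sum_(i in M) #|~: A i|)%N.
    under eq_bigr do rewrite /f -sum1dep_card.
    under [RHS]eq_bigr do rewrite -sum1_card.
    rewrite (exchange_big_dep (mem M))/=; last by move=> ? ? _ /andP[].
    apply: eq_bigr => i /= iM; apply: eq_bigl => x.
    by rewrite finset.in_setC (iM : i \in M).
  rewrite natr_sum; apply: (le_trans (ler_sum _ (fun i _ => Aq i))).
  by rewrite sumr_const -[leLHS]mulr_natr.
exists (x |: Y)%SET.
  by rewrite (leq_trans (leq_card_setU _ _))// cards1.
rewrite exprS -mulrA; apply: le_trans (ler_wpM2l q0 hY); apply: le_trans hx.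
rewrite ler_nat subset_leq_card//; apply/fintype.subsetP => i.
by rewrite !inE -finset.setI_eq0 finset.setIUl finset.setU_eq0 !finset.setI_eq0
  disjoints1 => /andP[-> ->].
Qed.

Lemma hitting_threshold_of_pow (R : realType) (q : R) (k : nat) :
  (0 < k)%N -> 0 <= q <= 1 -> q ^+ k = 15^-1 ->
  hitting_threshold (2 * k) k (1 - q).
Proof.
move=> k0 /andP[q0 q1] qk X A hA.
have A0 i : exists x, x \in A i.
  apply/set0Pn; rewrite -card_gt0 -(ltr_nat R).
  by apply: le_lt_trans (hA i); rewrite mulr_ge0// subr_ge0.
have k20 : (0 < 2 * k)%N by rewrite muln_gt0.
have X0 : (0 < #|X|)%N.
  by have [x _] := A0 (Ordinal k20); apply/card_gt0P; exists x.
pose m := ((2 * k) %/ 5)%N; pose j := (k - m)%N.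
have qj : q ^+ j <= 5^-1.
  (* Fifth powers keep the exponents integral: q^(5j) <= q^(3k) = 15^(-3) <= 5^(-5). *)
  rewrite -(ler_pXn2r (n := 5))// ?nnegrE ?exprn_ge0 ?invr_ge0// -exprM.
  have jk : (k * 3 <= j * 5)%N by rewrite /j /m; lia.
  apply: le_trans (ler_wiXn2l q0 q1 jk) _.
  rewrite exprM qk.
  lra.
have [|Y Yj hY] := @greedy_hitting R q X _ A j q0 X0.
  move=> i; have := hA i; rewrite -(cardsC (A i)) natrD.
  lra.
set M := [set i | _]%SET in hY.
have Mm : (#|M| <= m)%N.
  (* Since |M| is an integer, the real bound 2k/5 suffices to bound it by the floor [m]. *)
  rewrite leq_divRL// -(ler_nat R) natrM.
  move: hY; rewrite card_ord => hY.
  have := le_trans hY (ler_wpM2r (ler0n _ _) qj).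
  lra.
have /choice[g gA] := A0.
exists (Y :|: g @: M)%SET.
  apply: leq_trans (leq_card_setU _ _) _.
  rewrite -[leqRHS](@subnK m) ?leq_add ?(leq_trans (leq_imset_card _ _))//.
  by rewrite /m; lia.
move=> i; have [iM|] := boolP (i \in M).
  by exists (g i) => //; rewrite inE imset_f ?orbT.
rewrite inE => /pred0Pn[x /andP[xY xA]].
by exists x => //; rewrite inE (xY : x \in Y).
Qed.

Theorem theorem7 (R : realType) (k : nat) (hk : (0 < k)%N) :
  beta R (2 * k) k <= 1 - 1 / (15 `^ (k%:R^-1)) /\
  alpha R (2 * k - 1) k >= 1 / (15 `^ (k%:R^-1)).
Proof.
set q : R := 1 / _.
have hq : hitting_threshold (2 * k) k (1 - q).
  apply: hitting_threshold_of_pow => //.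
    rewrite /q div1r invr_ge0 powR_ge0 invf_le1 ?powR_gt0//.
    rewrite /= -[leLHS](powRr0 (15 : R)).
    by apply: ler_powR; rewrite ?invr_ge0// ler1n.
  rewrite /q div1r exprVn -powR_mulrn ?powR_ge0// -powRrM mulVf ?powRr1//.
  by rewrite pnatr_eq0 -lt0n.
split.
  by apply: beta_minimal => //; rewrite muln_gt0.
apply: alpha_maximal; first by lia.
rewrite -[q](subKr 1).
apply: depth_fraction_of_hitting_threshold; first by lia.
(* In dimension 2k - 1 the Helly number d + 1 is the number 2k of sets in the threshold. *)
by rewrite subn1 prednK// muln_gt0.
Qed.
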